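(* Let $\mathcal T=[\mathbf A,\mathbf B,\mathbf C]_R$ with $\mathbf A\in\mathbb F^{I\times R}$, $\mathbf B\in\mathbb F^{J\times R}$, $\mathbf C\in\mathbb F^{K\times R}$, and let $(\mathbf X,\mathbf Y,\mathbf Z)$ coincide with $(\mathbf A,\mathbf B,\mathbf C)$, $(\mathbf B,\mathbf C,\mathbf A)$, or $(\mathbf C,\mathbf A,\mathbf B)$. If $$k_{\mathbf X}+r_{\mathbf Y}+r_{\mathbf Z}\ge 2R+2\qquad\text{and}\qquad \min(r_{\mathbf Z}+k_{\mathbf Y},\ k_{\mathbf Z}+r_{\mathbf Y})\ge R+2,$$ then $r_{\mathcal T}=R$ and the CPD of $\mathcal T$ is unique.
   Context: $\mathbb F$ is $\mathbb R$ or $\mathbb C$. For matrices $\mathbf A,\mathbf B,\mathbf C$ with $R$ nonzero columns each, $[\mathbf A,\mathbf B,\mathbf C]_R:=\sum_{r=1}^R\mathbf a_r\circ\mathbf b_r\circ\mathbf c_r$ ($\circ$ = outer product). The rank $r_{\mathcal T}$ of a tensor is the minimal number of terms in such a representation; a representation with $R=r_{\mathcal T}$ terms is a canonical polyadic decomposition (CPD). The CPD of a tensor $\mathcal T$ of rank $R$ is unique if $\mathcal T=[\mathbf A,\mathbf B,\mathbf C]_R=[\bar{\mathbf A},\bar{\mathbf B},\bar{\mathbf C}]_R$ implies that there are an $R\times R$ permutation matrix $\mathbf\Pi$ and nonsingular diagonal matrices $\mathbf\Lambda_{\mathbf A},\mathbf\Lambda_{\mathbf B},\mathbf\Lambda_{\mathbf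 C}$ with $\bar{\mathbf A}=\mathbf A\mathbf\Pi\mathbf\Lambda_{\mathbf A}$, $\bar{\mathbf B}=\mathbf B\mathbf\Pi\mathbf\Lambda_{\mathbf B}$, $\bar{\mathbf C}=\mathbf C\mathbf\Pi\mathbf\Lambda_{\mathbf C}$, $\mathbf\Lambda_{\mathbf A}\mathbf\Lambda_{\mathbf B}\mathbf\Lambda_{\mathbf C}=\mathbf I_R$. $r_{\mathbf M}$ is the rank of a matrix $\mathbf M$; its $k$-rank $k_{\mathbf M}$ is the largest $k$ such that every set of $k$ columns of $\mathbf M$ is linearly independent. *)

(* Defs.v *)
From mathcomp Require Import all_boot all_fingroup all_algebra.
From mathcomp Require Import reals complex.

Set Implicit Arguments.
Unset Strict Implicit.
Unset Printing Implicit Defensive.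

Import GRing.Theory.
Local Open Scope ring_scope.

(* [real_or_complex RR F] : F is the field RR of real numbers or its field
   RR[i] of complex numbers. *)
Inductive real_or_complex (RR : realType) : fieldType -> Prop :=
| is_real : real_or_complex RR RR
| is_complex : real_or_complex RR RR[i].

Notation tensor F I J K := {ffun 'I_I * 'I_J * 'I_K -> F}.

Section Tensors.
Variable F : fieldType.

Definition outer I J K (a : 'cV[F]_I) (b : 'cV[F]_J) (c : 'cV[F]_K) :
    tensor F I J K :=
  [ffun ijk => a ijk.1.1 0 * b ijk.1.2 0 * c ijk.2 0].

Definition outer_sum I J K R
    (A : 'M[F]_(I, R)) (B : 'M[F]_(J, R)) (C : 'M[F]_(K, R)) :
    tensor F I J K :=
  \sum_(r < R) outer (col r A) (col r B) (col r C).

Definition nonzero_cols m R (A : 'M[F]_(m, R)) : Prop :=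
  forall r : 'I_R, col r A != 0.

(* T = [A, B, C]_R, including the convention that the columns are nonzero. *)
Definition polyadic I J K R (T : tensor F I J K)
    (A : 'M[F]_(I, R)) (B : 'M[F]_(J, R)) (C : 'M[F]_(K, R)) : Prop :=
  [/\ nonzero_cols A, nonzero_cols B, nonzero_cols C & T = outer_sum A B C].

Definition has_polyadic I J K (T : tensor F I J K) (R : nat) : Prop :=
  exists (A : 'M[F]_(I, R)) (B : 'M[F]_(J, R)) (C : 'M[F]_(K, R)),
    polyadic T A B C.

Definition is_tensor_rank I J K (T : tensor F I J K) (R : nat) : Prop :=
  has_polyadic T R /\ (forall R', has_polyadic T R' -> (R <= R')%N).

Definition cpd_unique I J K (T : tensor F I J K) : Prop :=
  forall R : nat, is_tensor_rank T R ->
  forall (A A' : 'M[F]_(I, R)) (B B' : 'M[F]_(J, R)) (C C' : 'M[F]_(K, R)),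
    polyadic T A B C -> polyadic T A' B' C' ->
  exists (s : 'S_R) (LA LB LC : 'M[F]_R),
    [/\ [/\ is_diag_mx LA, is_diag_mx LB & is_diag_mx LC],
        [/\ LA \in unitmx, LB \in unitmx & LC \in unitmx],
        [/\ A' = A *m perm_mx s *m LA,
            B' = B *m perm_mx s *m LB &
            C' = C *m perm_mx s *m LC] &
        LA *m LB *m LC = 1%:M].

(* The bound k < R.+1 excludes the k > R, for which the condition on sets of
   k columns is vacuous.  [free] is taken on the indexed family of columns, so
   repeated columns count as dependent. *)
Definition krank m R (A : 'M[F]_(m, R)) : nat :=
  \max_(k < R.+1 | [forall S : {set 'I_R},
                      (#|S| == k) ==> free [seq col j A | j in S]]) k.

Definition rank_conditions m n p R
    (X : 'M[F]_(m, R)) (Y : 'M[F]_(n, R)) (Z : 'M[F]_(p, R)) : Prop :=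
  (2 * R + 2 <= krank X + \rank Y + \rank Z)%N /\
  (R + 2 <= minn (\rank Z + krank Y) (krank Z + \rank Y))%N.

End Tensors.

(* Main.v *)
(* Idea (after Lovitz and Petrov). Call a family of vectors connected if its
   span is not the direct sum of the spans of two complementary nonempty
   subfamilies. A connected family of nonzero product vectors u_a (x) v_a spans
   a space of dimension at least dim <u_a> + dim <v_a> - 1: starting from one
   index, enlarge the index set S by a minimal C disjoint from S with
   <x_C> meeting <x_S>; this adds at least #|C| - 1 to the left-hand side and
   at most #|C| - 1 to the right-hand side. Iterating, three factors give the
   bound d_1 + d_2 + d_3 - 2.
   The difference of two polyadic decompositions splits into minimal zero sums,
   which are connected, so each of them, of size N, has
   d_1 + d_2 + d_3 <= N + 1. The rank conditions imply
   d_A(S) + d_B(S) + d_C(S) >= 2 #|S| + 2 for every set S of at least two terms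
   of [A, B, C], so a minimal zero sum with at least two terms of [A, B, C]
   contains strictly more terms of the other decomposition. Counting then gives
   the rank and pairs off the terms. *)
Require Import Defs.
From mathcomp Require Import all_boot all_fingroup all_algebra.
From mathcomp Require Import reals complex.
From mathcomp Require Import zify ring.

Set Implicit Arguments.
Unset Strict Implicit.
Unset Printing Implicit Defensive.

Import GRing.Theory.
Local Open Scope ring_scope.

(** * Spans of families of vectors, and connectedness *)

Section Spans.
Variables (F : fieldType) (T : finType).

Definition fspan n (x : T -> 'rV[F]_n) (S : {set T}) : 'M[F]_n :=
  (\sum_(a in S) <<x a>>)%MS.

Definition fdim n (x : T -> 'rV[F]_n) (S : {set T}) : nat :=
  \rank (fspan x S).

Variables (n : nat) (x : T -> 'rV[F]_n).
Implicit Types S E C : {set T}.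

Lemma mem_fspan S a : a \in S -> (x a <= fspan x S)%MS.
Proof. by move=> aS; apply: (sumsmx_sup a) => //; rewrite genmxE. Qed.

Lemma fspan_subP m S (B : 'M[F]_(m, n)) :
  reflect (forall a, a \in S -> (x a <= B)%MS) (fspan x S <= B)%MS.
Proof.
apply: (iffP sumsmx_subP) => H a aS; first by rewrite -genmxE H.
by rewrite genmxE H.
Qed.

Lemma fspanS S1 S2 : S1 \subset S2 -> (fspan x S1 <= fspan x S2)%MS.
Proof. by move/subsetP => s12; apply/fspan_subP => a /s12; apply: mem_fspan. Qed.

Lemma fdimS S1 S2 : S1 \subset S2 -> (fdim x S1 <= fdim x S2)%N.
Proof. by move=> s12; apply/mxrankS/fspanS. Qed.

Lemma fspanP S (y : 'rV[F]_n) :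
  reflect (exists c : T -> F, y = \sum_(a in S) c a *: x a)
          (y <= fspan x S)%MS.
Proof.
apply: (iffP idP) => [/sub_sumsmxP [w ->]|[c ->]]; last first.
  by apply: summx_sub => a aS; apply: scalemx_sub; apply: mem_fspan.
have /fin_all_exists [c cP] : forall a, exists c, w a *m <<x a>>%MS = c *: x a.
  by move=> a; apply/sub_rVP/(submx_trans (submxMl _ _)); rewrite genmxE.
by exists c; apply: eq_bigr.
Qed.

Lemma fspanU S1 S2 : (fspan x (S1 :|: S2) <= fspan x S1 + fspan x S2)%MS.
Proof.
apply/fspan_subP => a; rewrite inE => /orP [] /mem_fspan /submx_trans; apply.
  exact: addsmxSl.
exact: addsmxSr.
Qed.

Lemma fdim_le_card S : (fdim x S <= #|S|)%N.
Proof.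
rewrite -sum1_card /fdim /fspan.
apply: leq_trans (mxrank_sum_leqif _).1 _ => /=.
by apply: leq_sum => a _; rewrite genmxE rank_leq_row.
Qed.

Lemma fdim_sub_card S1 S2 : S1 \subset S2 ->
  (fdim x S2 <= fdim x S1 + #|S2 :\: S1|)%N.
Proof.
move=> s12; rewrite -{1}(setID S2 S1) (setIidPr s12).
apply: leq_trans (mxrankS (fspanU _ _)) _.
by apply: leq_trans (mxrank_adds_leqif _ _) _; rewrite leq_add2l fdim_le_card.
Qed.

(** If no member lies in the span of the others, none is zero and the lines they generate form a
    direct sum, of dimension [#|S|]. *)
Lemma fdim_lt_card S : (fdim x S < #|S|)%N ->
  exists2 a, a \in S & (x a <= fspan x (S :\ a))%MS.
Proof.
case: (pickP [pred a in S | (x a <= fspan x (S :\ a))%MS]) => [a /andP [] | H].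
  by exists a.
have nz a : a \in S -> x a != 0.
  by move=> aS; apply/eqP => x0; have:= H a; rewrite /= aS x0 sub0mx.
rewrite /fdim /fspan.
suff /mxdirectP /= -> : mxdirect (\sum_(a in S) <<x a>>)%MS.
  rewrite (eq_bigr (fun=> 1%N)) ?sum1_card ?ltnn // => a aS.
  by rewrite genmxE rank_rV nz.
apply/mxdirect_sumsP => a aS; apply/eqP; rewrite -submx0; apply/rV_subP => y.
rewrite sub_capmx genmxE => /andP [/sub_rVP [c ->]].
have [-> | c0] := eqVneq c 0; first by rewrite scale0r !sub0mx.
rewrite eqmx_scale // (eq_bigl (mem (S :\ a))) => [xa|b]; last by rewrite !inE andbC.
by have:= H a; rewrite /= aS xa.
Qed.

Lemma fdim_lt_card_of_sum0 S :
  S != set0 -> \sum_(a in S) x a = 0 -> (fdim x S < #|S|)%N.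
Proof.
case/set0Pn => a aS; rewrite (bigD1 a) //= => /eqP; rewrite addr_eq0 => /eqP xa.
rewrite (cardsD1 a) aS ltnS; apply: leq_trans (fdim_le_card _).
apply/mxrankS/fspan_subP => b bS; have [-> | ba] := eqVneq b a; last first.
  by apply: mem_fspan; rewrite !inE ba.
rewrite xa -scaleN1r; apply: scalemx_sub; apply: summx_sub => c /andP [cS ca].
by apply: mem_fspan; rewrite !inE ca.
Qed.

Definition connected_family E : Prop :=
  forall S, S \subset E -> S != set0 -> S != E ->
    (fspan x S :&: fspan x (E :\: S))%MS != 0.

(** A proper partial sum is nonzero and is minus the sum over the complement, so it lies in both
    spans. *)
Lemma connected_of_minimal_sum0 E :
  \sum_(a in E) x a = 0 ->
  (forall S, S \subset E -> S != set0 -> S != E -> \sum_(a in S) x a != 0) ->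
  connected_family E.
Proof.
move=> E0 minE S sSE S0 SE; apply: contraNneq (minE S sSE S0 SE) => cap0.
have yS : ((\sum_(a in S) x a)%R <= fspan x S)%MS.
  by apply: summx_sub => a; apply: mem_fspan.
move: E0; rewrite (big_setID S) /= (setIidPr sSE) => /eqP.
rewrite addr_eq0 => /eqP yN; rewrite -submx0 -cap0 sub_capmx yS yN -scaleN1r.
by apply: scalemx_sub; apply: summx_sub => a; apply: mem_fspan.
Qed.

End Spans.

(** * Product vectors and the spans of their factors *)

Section KhatriRao.
Variables (F : fieldType) (T : finType).

(* Rows of the Khatri-Rao product of the families u and v. *)
Definition kr m n (u : T -> 'rV[F]_m) (v : T -> 'rV[F]_n) (a : T) :
  'rV[F]_(m * n) := mxvec ((u a)^T *m v a).

Variables (m n : nat) (u : T -> 'rV[F]_m) (v : T -> 'rV[F]_n).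
Implicit Types S E C : {set T}.

Lemma kr_neq0 a : u a != 0 -> v a != 0 -> kr u v a != 0.
Proof.
move=> /rV0Pn [i ui] /rV0Pn [j vj]; rewrite /kr mxvec_eq0; apply/matrix0Pn.
by exists i, j; rewrite mxE big_ord1 !mxE mulf_neq0.
Qed.

Lemma vec_mx_kr_sum S (c : T -> F) :
  vec_mx (\sum_(a in S) c a *: kr u v a) = \sum_(a in S) c a *: ((u a)^T *m v a).
Proof. by rewrite linear_sum; apply: eq_bigr => a _; rewrite linearZ /= mxvecK. Qed.

(** Read as a matrix, a combination of product vectors has its rows in the span of the right
    factors; its columns are treated in [fspan_krl]. *)
Lemma fspan_krr S (y : 'rV_(m * n)) :
  (y <= fspan (kr u v) S)%MS -> (vec_mx y <= fspan v S)%MS.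
Proof.
case/fspanP => c ->; rewrite vec_mx_kr_sum; apply: summx_sub => a aS.
by apply: scalemx_sub; rewrite mulmx_sub ?mem_fspan.
Qed.

Lemma fspan_krl S (y : 'rV_(m * n)) :
  (y <= fspan (kr u v) S)%MS -> ((vec_mx y)^T <= fspan u S)%MS.
Proof.
case/fspanP => c ->; rewrite vec_mx_kr_sum linear_sum; apply: summx_sub => a aS.
by rewrite linearZ /= trmx_mul trmxK; apply: scalemx_sub; rewrite mulmx_sub ?mem_fspan.
Qed.

(** A vector common to two spans of products has, as a matrix, its rows in both spans of right
    factors; if these meet in 0, it vanishes. *)
Lemma connected_krr E : connected_family (kr u v) E -> connected_family v E.
Proof.
move=> cE S sSE S0 SE; apply: contraNneq (cE S sSE S0 SE) => cap0.
rewrite -submx0; apply/rV_subP => y; rewrite sub_capmx => /andP [yS yE].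
rewrite submx0 -(vec_mxK y) mxvec_eq0 -submx0 -cap0.
by rewrite sub_capmx !fspan_krr.
Qed.

(* Sylvester gives rank (P X) + rank Q <= k; if Q Y had the rank of Q, then Q
   would factor as Q Y W and P^T Q = 0 would follow from P^T Q Y = 0. *)
Lemma rank_mul_cokernels k p q (P : 'M[F]_(k, m)) (Q : 'M[F]_(k, n))
    (X : 'M[F]_(m, p)) (Y : 'M[F]_(n, q)) :
  P^T *m Q *m Y = 0 -> Q^T *m P *m X = 0 -> P^T *m Q != 0 ->
  (\rank (P *m X) + \rank (Q *m Y) < k)%N.
Proof.
move=> PQY QPX PQ0.
have XPQ : (P *m X)^T *m Q = 0.
  by apply: trmx_inj; rewrite trmx_mul trmxK mulmxA QPX trmx0.
have le_k := mulmx0_rank_max XPQ; rewrite mxrank_tr in le_k.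
apply: leq_trans le_k; rewrite ltn_add2l ltn_neqAle mxrankM_maxl andbT.
apply: contraNneq PQ0 => rQ.
have /submxP [W QW] : (Q^T <= (Q *m Y)^T)%MS.
  have /mxrank_leqif_sup [_ <-] : ((Q *m Y)^T <= Q^T)%MS.
    by rewrite trmx_mul submxMl.
  by rewrite !mxrank_tr rQ.
by rewrite -[Q]trmxK QW trmx_mul trmxK !mulmxA PQY mul0mx.
Qed.

End KhatriRao.

(** * Dimension bounds for connected families and zero sums *)

Section ConnectedDimension.
Variables (F : fieldType) (T : finType).
Implicit Types S E C : {set T}.

(** Multiplying by [cokermx] passes to the quotient by the span over [S], so the last rank bounds
    the dimension gained by adding [C]. *)
Lemma fdimU_cokermx m k (u : T -> 'rV[F]_m) S C (P : 'M[F]_(k, m)) :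
  (fspan u C <= P)%MS ->
  (fdim u (S :|: C) <= fdim u S + \rank (P *m cokermx (fspan u S)))%N.
Proof.
move=> uC; rewrite /fdim -(mxrank_mul_ker _ (cokermx (fspan u S))) addnC.
apply: leq_add; apply: mxrankS.
  by rewrite submxE; apply/eqP/sub_kermxP; rewrite capmxSr.
apply: submx_trans (submxMr _ (fspanU _ _ _)) _.
by rewrite addsmxMr mulmx_coker adds0mx submxMr.
Qed.

Lemma kr_fdim_extend m n (u : T -> 'rV[F]_m) (v : T -> 'rV[F]_n) S C
    (x := kr u v) :
  (fspan x C :&: fspan x S)%MS != 0 ->
  (forall D : {set T}, D \proper C -> (fspan x D :&: fspan x S)%MS = 0) ->
  (fdim u S + fdim v S <= fdim x S + 1)%N ->
  (fdim u (S :|: C) + fdim v (S :|: C) <= fdim x (S :|: C) + 1)%N.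
Proof.
move=> capC minC IH.
have notin_span c : c \in C -> ~~ (x c <= fspan x (C :\ c))%MS.
  move=> cC; apply: contra capC => xc.
  rewrite -submx0 -(minC (C :\ c)) ?properD1 // capmxS //.
  apply/fspan_subP => b bC; have [-> // | bc] := eqVneq b c.
  by apply: mem_fspan; rewrite !inE bc.
have [y yCS y0] : exists2 y : 'rV_(m * n), (y <= fspan x C :&: fspan x S)%MS & y != 0.
  by apply/rowV0Pn.
move: yCS; rewrite sub_capmx => /andP [/fspanP [c yE] yS].
have c0 a : a \in C -> c a != 0.
  move=> aC; apply: contraNneq y0 => ca.
  rewrite -submx0 -(minC (C :\ a)) ?properD1 // sub_capmx yS andbT.
  apply/fspanP; exists c; rewrite yE (big_setD1 a) //= ca scale0r add0r //.
(* By minimality, [C] without one index is independent and its span meets that of [S] only in 0. *)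
have dimC : (fdim x S + #|C| <= fdim x (S :|: C) + 1)%N.
  have /set0Pn [a aC] : C != set0.
    by apply: contraNneq capC => ->; rewrite /fspan big_set0 cap0mx.
  have dimD : fdim x (C :\ a) = #|C :\ a|.
    apply/eqP; rewrite eqn_leq fdim_le_card leqNgt; apply/negP => /fdim_lt_card.
    case=> b; rewrite inE => /andP [_ bC] xb; case/negP: (notin_span b bC).
    by apply: submx_trans xb (fspanS _ _); rewrite setSD ?subD1set.
  rewrite (cardsD1 a C) aC -dimD addnCA addnC leq_add2r -mxrank_disjoint_sum.
    apply: mxrankS; rewrite addsmx_sub !fspanS ?subsetUl //.
    by rewrite (subset_trans (subD1set _ _)) ?subsetUr.
  by rewrite capmxC minC ?properD1.
(* Folding the coefficients into [P] makes [y] the matrix [P^T *m Q]. As they are nonzero, the rows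
   of [P] still span the [u]-vectors of [C]. *)
pose P := \matrix_(i < #|C|) (c (enum_val i) *: u (enum_val i)).
pose Q := \matrix_(i < #|C|) v (enum_val i).
have yPQ : vec_mx y = P^T *m Q.
  rewrite yE vec_mx_kr_sum big_enum_val; apply/matrixP => i j.
  rewrite summxE mxE; apply: eq_bigr => k _.
  by rewrite !mxE big_ord1 !mxE mulrA.
have uP : (fspan u C <= P)%MS.
  apply/fspan_subP => a aC; rewrite -(eqmx_scale _ (c0 a aC)).
  by apply: (eq_row_sub (enum_rank_in aC a)); rewrite rowK enum_rankK_in.
have vQ : (fspan v C <= Q)%MS.
  apply/fspan_subP => a aC.
  by apply: (eq_row_sub (enum_rank_in aC a)); rewrite rowK enum_rankK_in.
have := fdimU_cokermx S uP; have := fdimU_cokermx S vQ.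
suff: (\rank (P *m cokermx (fspan u S)) + \rank (Q *m cokermx (fspan v S)) < #|C|)%N.
  by lia.
apply: rank_mul_cokernels; rewrite -?yPQ.
- by apply/eqP; rewrite -submxE; apply: fspan_krr yS.
- by rewrite -[Q^T *m P]trmxK trmx_mul trmxK -yPQ; apply/eqP; rewrite -submxE; apply: fspan_krl yS.
- by apply: contraNneq y0 => y0; rewrite -(vec_mxK y) y0 linear0.
Qed.

Lemma kr_fdim_connected m n (u : T -> 'rV[F]_m) (v : T -> 'rV[F]_n) E :
  E != set0 -> {in E, forall a, kr u v a != 0} ->
  connected_family (kr u v) E ->
  (fdim u E + fdim v E <= fdim (kr u v) E + 1)%N.
Proof.
case/set0Pn => a0 a0E nz cE; pose x := kr u v.
pose p S := [&& S != set0, S \subset E & fdim u S + fdim v S <= fdim x S + 1]%N.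
have p1 : p [set a0].
  rewrite /p sub1set a0E -card_gt0 cards1 /=.
  have := fdim_le_card u [set a0]; have := fdim_le_card v [set a0].
  rewrite cards1; suff : (0 < fdim x [set a0])%N by lia.
  by rewrite lt0n mxrank_eq0 /fspan big_set1 -submx0 genmxE submx0 nz.
(* A maximal [S] with the bound is [E]: otherwise connectedness gives a minimal [C] outside [S] to
   adjoin, and maximality forces [C] to be empty. *)
have [S /maxsetP [/and3P [S0 sSE pS] maxS] _] := maxset_exists p1.
have [<- // | SE] := eqVneq S E.
pose q C := (C \subset E :\: S) && ((fspan x C :&: fspan x S)%MS != 0).
have qE : q (E :\: S) by rewrite /q subxx capmxC cE.
have [C /minsetP [/andP [sCE capC] minC] _] := minset_exists qE.
have SC : S :|: C = S.
  apply: maxS (subsetUl _ _); rewrite /p setU_eq0 negb_and S0 subUset sSE.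
  rewrite (subset_trans sCE) ?subsetDl //= kr_fdim_extend // => D ltDC.
  have [sDC neDC] := (proper_sub ltDC, proper_neq ltDC).
  apply/eqP; apply: contraNT neDC => capD; apply/eqP; apply: minC (sDC).
  by rewrite /q capD (subset_trans sDC).
case/negP: capC; have /eqP -> : C == set0; last first.
  by rewrite /fspan big_set0 cap0mx.
rewrite -subset0; apply/subsetP => a aC; move/subsetP/(_ a aC): sCE.
by rewrite -SC !inE aC orbT.
Qed.

Variables (m n p : nat) (u : T -> 'rV[F]_m) (v : T -> 'rV[F]_n) (w : T -> 'rV[F]_p).
Hypotheses (u0 : forall a, u a != 0) (v0 : forall a, v a != 0)
  (w0 : forall a, w a != 0).
Let x := kr u (kr v w).

(** The two-factor bound is used for [u] against [kr v w], then for [v] against [w]; the vanishing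
    sum makes the span smaller than [#|E|]. *)
Lemma kr3_fdim_minimal_sum0 E :
  E != set0 -> \sum_(a in E) x a = 0 ->
  (forall S, S \subset E -> S != set0 -> S != E -> \sum_(a in S) x a != 0) ->
  (fdim u E + fdim v E + fdim w E <= #|E| + 1)%N.
Proof.
move=> E0 sumE minE; have cE := connected_of_minimal_sum0 sumE minE.
have vw0 a : kr v w a != 0 by apply: kr_neq0.
have := kr_fdim_connected E0 (fun a _ => vw0 a) (connected_krr cE).
have := kr_fdim_connected E0 (fun a _ => kr_neq0 (u0 a) (vw0 a)) cE.
have := fdim_lt_card_of_sum0 E0 sumE; rewrite -/x; lia.
Qed.

(** Meant for [L] indexing one decomposition and its complement the negated terms of another. *)
Lemma kr3_sum0_matching (L E : {set T}) :
  (forall S, S \subset L -> 1 < #|S| ->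
     2 * #|S| + 2 <= fdim u S + fdim v S + fdim w S)%N ->
  \sum_(a in E) x a = 0 ->
  (#|E :&: L| <= #|E :\: L|)%N /\
  (#|E :&: L| = #|E :\: L| ->
   {in E :&: L, forall a, exists2 b, b \in E :\: L & x a + x b = 0}).
Proof.
move=> dimL; have [k] := ubnP #|E|; elim: k E => // k IH E ltEk sumE.
have [E0 | E0] := eqVneq E set0.
  by rewrite E0 set0I set0D; split=> // _ a; rewrite inE.
(* A proper zero subsum splits [E] into two smaller zero sums. The counts add up, so equality for
   [E] forces equality in both. *)
case: (pickP [pred S : {set T} | [&& S \subset E, S != set0, S != E &
                         \sum_(a in S) x a == 0]]) => [S | minE].
  case/and4P=> sSE S0 SE /eqP sumS.
  have cE := cardsID S E; rewrite (setIidPr sSE) in cE.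
  have S_gt0 : (0 < #|S|)%N by rewrite card_gt0.
  have S_lt : (#|S| < #|E|)%N by rewrite proper_card // properEneq SE.
  have sumD : \sum_(a in E :\: S) x a = 0.
    by move: sumE; rewrite (big_setID S) /= (setIidPr sSE) sumS add0r.
  have [le1 eq1] := IH S (ltac:(lia)) sumS.
  have [le2 eq2] := IH (E :\: S) (ltac:(lia)) sumD.
  have cI := cardsID S (E :&: L); have cD := cardsID S (E :\: L).
  have IS : E :&: L :&: S = S :&: L by rewrite -setIA (setIC L) setIA (setIidPr sSE).
  have ID : E :&: L :\: S = (E :\: S) :&: L by rewrite setIDAC.
  have DS : (E :\: L) :&: S = S :\: L by rewrite setIDAC (setIidPr sSE).
  have DD : E :\: L :\: S = (E :\: S) :\: L by rewrite !setDDl setUC.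
  rewrite IS ID in cI; rewrite DS DD in cD; split; first lia.
  move=> eqE a aEL; have [aS | aS] := boolP (a \in S).
    have [||b bS ab] := eq1 _ a; first lia.
      by rewrite !inE in aEL *; rewrite aS; case/andP: aEL.
    by exists b => //; rewrite -DS in bS; case/setIP: bS.
  have [||b bS ab] := eq2 _ a; first lia.
    by rewrite !inE in aEL *; rewrite aS.
  by exists b => //; rewrite -DD in bS; case/setDP: bS.
have {}minE S : S \subset E -> S != set0 -> S != E -> \sum_(a in S) x a != 0.
  by move=> sSE S0 SE; have := minE S; rewrite /= sSE S0 SE /= => /negbT.
have dimE := kr3_fdim_minimal_sum0 E0 sumE minE.
have cE := cardsID L E.
have E_gt0 : (0 < #|E|)%N by rewrite card_gt0.
(* With at least two terms in [L], the bounds give [2 * #|E :&: L| + 2 <= #|E| + 1], so the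
   inequality is strict. *)
have [gt1 | le1] := ltnP 1 #|E :&: L|.
  have := dimL _ (subsetIr E L) gt1; have sI := subsetIl E L.
  have := fdimS u sI; have := fdimS v sI; have := fdimS w sI.
  by move=> *; split; [lia | move=> ?; exfalso; lia].
(* A single product is nonzero, so a minimal zero sum has at least two terms; equal counts then
   leave one on each side. *)
have E_gt1 : (1 < #|E|)%N.
  rewrite ltn_neqAle E_gt0 andbT eq_sym; apply/negP => /cards1P [a Ea].
  move: sumE; rewrite Ea big_set1 => /eqP; apply/negP; do 2!apply: kr_neq0 => //.
split; first lia.
move=> eqE a aEL; have /eqP/cards1P [a' aE] : #|E :&: L| = 1%N by lia.
have /eqP/cards1P [b bE] : #|E :\: L| = 1%N by lia.
exists b; first by rewrite bE set11.
move: aEL sumE; rewrite (big_setID L) /= aE bE !big_set1.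
by move/set1P => ->.
Qed.

End ConnectedDimension.

(** * Rank and k-rank against dimensions of spans of columns *)

Lemma subset_of_card (T : finType) (S : {set T}) k :
  (k <= #|S|)%N -> exists2 D : {set T}, D \subset S & #|D| = k.
Proof.
case/card_geqP => s [us <- sS]; exists [set a in s].
  by apply/subsetP => a; rewrite inE => /sS.
by rewrite cardsE; apply/card_uniqP.
Qed.

Section ColumnFamilies.
Variable F : fieldType.

Definition colf m R (A : 'M[F]_(m, R)) (r : 'I_R) : 'rV[F]_m := (col r A)^T.

Lemma fdim_imset (T T' : finType) n (x : T' -> 'rV[F]_n) (f : T -> T')
    (S : {set T}) :
  injective f -> fdim x [set f a | a in S] = fdim (x \o f) S.
Proof. by move=> injf; rewrite /fdim /fspan big_imset //= => a b _ _; apply: injf. Qed.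

Variables (m R : nat) (A : 'M[F]_(m, R)).
Implicit Type S : {set 'I_R}.

(** Each column outside [S] adds at most one dimension. *)
Lemma rank_le_fdim S : (\rank A <= fdim (colf A) S + (R - #|S|))%N.
Proof.
have -> : (R - #|S| = #|[set: 'I_R] :\: S|)%N.
  by rewrite setTD [RHS]cardsCs setCK card_ord.
apply: leq_trans (fdim_sub_card _ (subsetT _)); rewrite -mxrank_tr.
apply/mxrankS/row_subP => r; rewrite -tr_col; exact: mem_fspan.
Qed.

Lemma free_fdim S : free [seq col j A | j in S] -> fdim (colf A) S = #|S|.
Proof.
move=> freeS; apply/eqP; rewrite eqn_leq fdim_le_card leqNgt.
apply/negP => /fdim_lt_card [a aS /fspanP [c ca]].
(* The dependent index is moved to the front for [free_cons]. *)
have eS : perm_eq (enum S) (a :: enum (S :\ a)).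
  apply: uniq_perm; rewrite /= ?enum_uniq ?mem_enum ?setD11 // => b.
  by rewrite inE !mem_enum !inE; case: eqVneq => [->|].
move: freeS; rewrite /image_mem (perm_free (perm_map _ eS)) /= free_cons.
case/andP => /negP []; rewrite (_ : col a A = \sum_(b in S :\ a) c b *: col b A).
  apply: memv_suml => b bS; apply: memvZ; apply: memv_span.
  by apply: map_f; rewrite mem_enum.
apply: trmx_inj; rewrite -/(colf A a) ca linear_sum.
by apply: eq_bigr => b _; rewrite linearZ.
Qed.

Lemma krank_le_fdim S : (minn (krank A) #|S| <= fdim (colf A) S)%N.
Proof.
have [|k kP kE] := @eq_bigmax_cond _ (fun k : 'I_R.+1 =>
   [forall S : {set 'I_R}, (#|S| == k) ==> free [seq col j A | j in S]]) val.
  (* The value 0 always qualifies, since the empty family is free; hence the maximum is attained. *)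
  apply/card_gt0P; exists ord0; apply/forallP => D.
  apply/implyP; rewrite /= cards_eq0 => /eqP ->.
  by rewrite /image_mem enum_set0 nil_free.
rewrite /krank [X in minn X _]kE /=; have {kP} freek (D : {set 'I_R}) : #|D| = k -> fdim (colf A) D = k.
  by move=> Dk; rewrite free_fdim //; move/forallP/(_ D)/implyP: kP; apply; apply/eqP.
have [leSk | /ltnW leKS] := leqP #|S| k.
  (* Enlarge [S] to [k] columns, which are independent; removing the added ones loses at most one
     dimension each. *)
  have kR : (k <= R)%N by rewrite -ltnS.
  have [|D sDS cD] := @subset_of_card _ (~: S) (k - #|S|).
    by rewrite [leqRHS]cardsCs setCK card_ord leq_sub2r.
  have SD0 : [disjoint S & D] by rewrite disjoint_sym disjoints_subset.
  have cSD : #|S :|: D| = k by rewrite cardsU disjoint_setI0 // cards0; lia.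
  rewrite -(subKn leSk) leq_subLR -cD addnC -(freek _ cSD).
  apply: leq_trans (fdim_sub_card _ (subsetUl S D)) _; rewrite leq_add2l.
  by rewrite setDUl setDv set0U subset_leq_card ?subsetDl.
have [D sDS cD] := subset_of_card leKS.
by have := fdimS (colf A) sDS; rewrite (freek _ cD); lia.
Qed.

(** Kruskal's inequality with span dimensions in place of k-ranks, imposed on every subfamily of at
    least two terms. *)
Definition kruskal_condition n p (B : 'M[F]_(n, R)) (C : 'M[F]_(p, R)) : Prop :=
  forall S, (1 < #|S|)%N ->
  (2 * #|S| + 2 <= fdim (colf A) S + fdim (colf B) S + fdim (colf C) S)%N.

End ColumnFamilies.

(** Let s be [#|S|]. If s exceeds [krank X], the first condition suffices, with [rank_le_fdim] for
    [Y] and [Z]. Otherwise [X] contributes s, and s + 2 more come from the second condition if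
    [krank Y] or [krank Z] is at most s, and from 2s >= s + 2 if not. *)
Lemma rank_conditions_kruskal (F : fieldType) m n p R
    (X : 'M[F]_(m, R)) (Y : 'M[F]_(n, R)) (Z : 'M[F]_(p, R)) :
  rank_conditions X Y Z -> kruskal_condition X Y Z.
Proof.
case=> cond1 cond2 S S_gt1.
have := (krank_le_fdim X S, krank_le_fdim Y S, krank_le_fdim Z S).
have := (rank_le_fdim X S, rank_le_fdim Y S, rank_le_fdim Z S).
have := (rank_leq_col X, rank_leq_col Y, rank_leq_col Z).
have leSR : (#|S| <= R)%N by rewrite -[leqRHS]card_ord max_card.
move: S_gt1 leSR; set s := #|S| => s_gt1 leSR.
move=> [[? ?] ?] [[? ?] ?] [[? ?] ?]; lia.
Qed.

(** * Comparison of two decompositions *)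

Section Uniqueness.
Variables (F : fieldType) (I J K : nat).

Lemma outer_inj (a a' : 'cV[F]_I) (b b' : 'cV[F]_J) (c c' : 'cV[F]_K) :
  a != 0 -> b != 0 -> c != 0 -> outer a b c = outer a' b' c' ->
  exists l : F * F * F,
    [/\ a' = l.1.1 *: a, b' = l.1.2 *: b, c' = l.2 *: c &
        l.1.1 * l.1.2 * l.2 = 1].
Proof.
move=> /cV0Pn [i ai] /cV0Pn [j bj] /cV0Pn [k ck] /ffunP E.
have {}E i' j' k' : a i' 0 * b j' 0 * c k' 0 = a' i' 0 * b' j' 0 * c' k' 0.
  by have := E (i', j', k'); rewrite !ffunE.
have : a' i 0 * b' j 0 * c' k 0 != 0 by rewrite -E !mulf_neq0.
rewrite !mulf_eq0 !negb_or => /andP [/andP [ai' bj'] ck'].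
(* The scalars are ratios at a position where all six entries are nonzero. *)
exists (a' i 0 / a i 0, b' j 0 / b j 0, c' k 0 / c k 0) => /=; split.
- apply/colP => r; rewrite mxE; apply: (mulIf (mulf_neq0 bj' ck')).
  rewrite mulrA -E [RHS](_ : _ = a' i 0 * b' j 0 * c' k 0 / a i 0 * a r 0); last by field.
  by rewrite -E; field.
- apply/colP => r; rewrite mxE; apply: (mulIf (mulf_neq0 ai' ck')).
  rewrite [LHS](_ : _ = a' i 0 * b' r 0 * c' k 0); last by ring.
  rewrite -E [RHS](_ : _ = a' i 0 * b' j 0 * c' k 0 / b j 0 * b r 0); last by field.
  by rewrite -E; field.
- apply/colP => r; rewrite mxE; apply: (mulIf (mulf_neq0 ai' bj')).
  rewrite mulrC -E [RHS](_ : _ = a' i 0 * b' j 0 * c' k 0 / c k 0 * c r 0); last by field.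
  by rewrite -E; field.
- rewrite [LHS](_ : _ = (a' i 0 * b' j 0 * c' k 0) / (a i 0 * b j 0 * c k 0)); last first.
    by field; rewrite ai bj ck.
  by rewrite -E; field; rewrite ai bj ck.
Qed.

Lemma outer_sumE R (A : 'M[F]_(I, R)) (B : 'M[F]_(J, R)) (C : 'M[F]_(K, R)) i j k :
  outer_sum A B C (i, j, k) = \sum_r A i r * B j r * C k r.
Proof. by rewrite /outer_sum sum_ffunE; apply: eq_bigr => r _; rewrite ffunE !mxE. Qed.

Variables (R R' : nat).
Variables (A : 'M[F]_(I, R)) (B : 'M[F]_(J, R)) (C : 'M[F]_(K, R)).
Hypotheses (nzA : nonzero_cols A) (nzB : nonzero_cols B) (nzC : nonzero_cols C).
Hypothesis kABC : kruskal_condition A B C.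

(** Two equal terms would have proportional columns in [A], giving dimensions at most 1 + 2 + 2,
    below the required 6. *)
Lemma kruskal_outer_inj :
  injective (fun r => outer (col r A) (col r B) (col r C)).
Proof.
move=> r s /(outer_inj (nzA r) (nzB r) (nzC r)) [l [As _ _ _]].
apply/eqP; apply/negPn/negP => rs.
have := kABC (S := [set r; s]); rewrite cards2 rs /= => /(_ isT).
have := fdim_le_card (colf B) [set r; s]; have := fdim_le_card (colf C) [set r; s].
suff : (fdim (colf A) [set r; s] <= 1)%N by rewrite cards2 rs; lia.
apply: leq_trans (rank_leq_row (colf A r)); apply/mxrankS/fspan_subP => a.
by rewrite !inE => /orP [] /eqP -> //; rewrite /colf As linearZ scalemx_sub.
Qed.

Lemma kruskal_matching (A' : 'M[F]_(I, R')) (B' : 'M[F]_(J, R')) (C' : 'M[F]_(K, R')) :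
  nonzero_cols A' -> nonzero_cols B' -> nonzero_cols C' ->
  outer_sum A B C = outer_sum A' B' C' ->
  (R <= R')%N /\
  (R = R' -> forall r, exists s,
    outer (col r A) (col r B) (col r C) = outer (col s A') (col s B') (col s C')).
Proof.
move=> nzA' nzB' nzC' /ffunP sumE.
(* The sign [e] is -1 in the first factor only, so each term of the second decomposition is negated
   once. *)
pose fam m (M : 'M[F]_(m, R)) (M' : 'M[F]_(m, R')) e (t : 'I_R + 'I_R') :=
  match t with inl r => colf M r | inr s => e *: colf M' s end.
pose u := fam _ A A' (- 1); pose v := fam _ B B' 1; pose w := fam _ C C' 1.
have nz m M M' (e : F) : e != 0 -> nonzero_cols M -> nonzero_cols M' ->
    forall t, fam m M M' e t != 0.
  move=> e0 nzM nzM' [r|s]; rewrite /= ?scaler_eq0 ?negb_or ?e0 trmx_eq0.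
    exact: nzM.
  exact: nzM'.
pose L : {set 'I_R + 'I_R'} := [set inl r | r : 'I_R].
have dimL (S : {set 'I_R + 'I_R'}) : S \subset L -> (1 < #|S| ->
    2 * #|S| + 2 <= fdim u S + fdim v S + fdim w S)%N.
  move=> /subsetP sSL; have -> : S = [set inl r | r in [set r | inl r \in S]].
    apply/setP => t; apply/idP/imsetP => [tS|[r]]; last by rewrite inE => ? ->.
    by have /imsetP [r _ tr] := sSL t tS; exists r; rewrite // inE -tr.
  have inl_inj : injective (@inl 'I_R 'I_R') by move=> ? ? [].
  by rewrite card_imset // !fdim_imset //; apply: kABC.
have krE t i j k : kr u (kr v w) t 0 (mxvec_index i (mxvec_index j k)) =
    u t 0 i * v t 0 j * w t 0 k.
  by rewrite !(mxvecE, mxE, big_ord1) mulrA.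
have sum0 : \sum_(t in [set: 'I_R + 'I_R']) kr u (kr v w) t = 0.
  apply/rowP => q; case/mxvec_indexP: q => i q; case/mxvec_indexP: q => j k.
  rewrite summxE [RHS]mxE.
  under eq_bigr do rewrite krE.
  rewrite (eq_bigl xpredT) => [|t]; last by rewrite inE.
  rewrite big_sumType /=; have := sumE (i, j, k); rewrite !outer_sumE => E.
  apply/eqP; rewrite addr_eq0 -sumrN; apply/eqP.
  transitivity (\sum_r A i r * B j r * C k r).
    by apply: eq_bigr => r _; rewrite !mxE.
  by rewrite E; apply: eq_bigr => s _; rewrite !mxE mulN1r !mul1r !mulNr opprK.
have [|||leLR eqLR] := kr3_sum0_matching _ _ _ dimL sum0.
- by apply: nz; rewrite ?oppr_eq0 ?oner_eq0.
- by apply: nz; rewrite ?oner_eq0.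
- by apply: nz; rewrite ?oner_eq0.
have cL : #|[set: 'I_R + 'I_R'] :&: L| = R.
  by rewrite setTI card_imset ?card_ord // => ? ? [].
have cR : #|[set: 'I_R + 'I_R'] :\: L| = R'.
  apply/eqP; rewrite -(eqn_add2l R) -{1}cL cardsID cardsT card_sum !card_ord //.
rewrite cL cR in leLR eqLR; split=> // eR r.
have [|[r'|s] sL rs] := eqLR eR (inl r); first by rewrite !inE imset_f.
  by move: sL; rewrite !inE imset_f.
exists s; apply/ffunP => [[[i j] k]]; rewrite !ffunE /=.
have /rowP/(_ (mxvec_index i (mxvec_index j k))) := rs.
rewrite mxE !krE !mxE mulN1r !mul1r !mulNr => /eqP; rewrite subr_eq0 => /eqP //.
Qed.

End Uniqueness.

(** * Tensor rank and uniqueness of the CPD *)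

Theorem corollary1p29 (RR : realType) (F : fieldType)
    (hF : real_or_complex RR F) (I J K R : nat)
    (A : 'M[F]_(I, R)) (B : 'M[F]_(J, R)) (C : 'M[F]_(K, R))
    (T : tensor F I J K) (hT : polyadic T A B C)
    (hXYZ : rank_conditions A B C \/ rank_conditions B C A \/
            rank_conditions C A B) :
  is_tensor_rank T R /\ cpd_unique T.
Proof.
have kABC : kruskal_condition A B C.
  (* The condition on subfamilies is symmetric in the three factors. *)
  case: hXYZ => [|[|]] /rank_conditions_kruskal // k S /k; lia.
have [nzA nzB nzC TE] := hT.
have rankT : is_tensor_rank T R.
  split=> [|R' [A' [B' [C' [nzA' nzB' nzC' TE']]]]]; first by exists A, B, C.
  by case: (kruskal_matching nzA nzB nzC kABC nzA' nzB' nzC') => //; rewrite -TE.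
split=> // R0 rankT0 A1 A2 B1 B2 C1 C2.
have eR : R0 = R.
  by apply/eqP; rewrite eqn_leq (rankT0.2 _ rankT.1) (rankT.2 _ rankT0.1).
subst R0.
pose term (X : 'M_(I, R)) (Y : 'M_(J, R)) (Z : 'M_(K, R)) (r : 'I_R) :=
  outer (col r X) (col r Y) (col r Z) : tensor F I J K.
(* Both given decompositions are compared with [A], [B], [C], for which the condition is known, and
   the two bijections are then composed. *)
have matching A' B' C' : polyadic T A' B' C' ->
    exists f : 'S_R, forall r, term A B C r = term A' B' C' (f r).
  case=> nzA' nzB' nzC' TE'.
  have sumE : outer_sum A B C = outer_sum A' B' C' by rewrite -TE.
  have [_ /(_ erefl) /fin_all_exists [f fE]] :=
    kruskal_matching nzA nzB nzC kABC nzA' nzB' nzC' sumE.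
  have injf : injective f.
    by move=> r s frs; apply: (kruskal_outer_inj nzA nzB nzC kABC); rewrite !fE frs.
  by exists (perm injf) => r; rewrite permE; apply: fE.
move=> p1 p2; have [f fE] := matching _ _ _ p1; have [g gE] := matching _ _ _ p2.
pose t : 'S_R := (g^-1 * f)%g.
have tE r : term A1 B1 C1 (t r) = term A2 B2 C2 r.
  by rewrite permM -fE gE permKV.
have [nzA1 nzB1 nzC1 _] := p1.
have /fin_all_exists [l lE] r :=
  outer_inj (nzA1 (t r)) (nzB1 (t r)) (nzC1 (t r)) (tE r).
pose Lam (h : F * F * F -> F) : 'M[F]_R := diag_mx (\row_r h (l r)).
have l_neq0 r : [/\ (l r).1.1 != 0, (l r).1.2 != 0 & (l r).2 != 0].
  have [_ _ _ l1] := lE r; have : (l r).1.1 * (l r).1.2 * (l r).2 != 0.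
    by rewrite l1 oner_eq0.
  by rewrite !mulf_eq0 !negb_or => /andP [/andP []].
have unitLam h : (forall r, h (l r) != 0) -> Lam h \in unitmx.
  move=> h0; rewrite unitmxE det_diag unitfE; apply/prodf_neq0 => r _.
  by rewrite mxE.
(* By [col_permE], column [r] of [X *m perm_mx t^-1] is column [t r] of [X], whence the inverse. *)
have colE m (X X' : 'M[F]_(m, R)) h : (forall r, col r X' = h (l r) *: col (t r) X) ->
    X' = X *m perm_mx t^-1 *m Lam h.
  move=> XE; apply/matrixP => i r; rewrite -col_permE mul_mx_diag !mxE.
  by have /colP/(_ i) := XE r; rewrite !mxE mulrC.
exists t^-1%g, (Lam (fun l => l.1.1)), (Lam (fun l => l.1.2)), (Lam snd); split.
- by split; apply: diag_mx_is_diag.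
- by split; apply: unitLam => r; case: (l_neq0 r).
- by split; apply: colE => r; case: (lE r).
rewrite /Lam !mulmx_diag; apply/matrixP => r s; rewrite !mxE.
by have [_ _ _ ->] := lE r.
Qed.
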